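(* Let $\beta>1$ be a real number, let $M\ge 1$ be a fixed integer, and let $A=\{-M,\ldots,M\}\subset\mathbb{Z}$. Then the set $Z_{\beta,M}$ is recognizable by a finite Büchi automaton if and only if the spectrum $S_A(\beta)$ has no accumulation point.
   Context: $Z_{\beta,M}=\{z_1z_2\cdots \mid z_i\in\{-M,\ldots,M\},\ \sum_{i\ge 1}z_i\beta^{-i}=0\}$ is the set of infinite words over $\{-M,\dots,M\}$ with value $0$ in base $\beta$. The $A$-spectrum of $\beta$ is $S_A(\beta)=\{\sum_{k=0}^n a_k\beta^k \mid n\in\mathbb{N},\ a_k\in A\}$. A point $s$ is an accumulation point of a set $X$ if every neighbourhood of $s$ contains infinitely many elements of $X$. An automaton over a finite alphabet $B$ is a directed graph with edges labeled by letters of $B$, with a set $Q$ of states, a set $I\subseteq Q$ of initial states and a set $T\subseteq Q$ of terminal states; it is finite if $Q$ is finite. An infinite path is successful if it starts in $I$ and goes infinitely often through $T$. The set of infinite words recognized by the (Büchi) automaton is the set of labels of its successful infinite paths. A set of infinite words over $B$ is recognizable by a finite Büchi automaton if it is the set recognized by some finite such automaton (not necessarily deterministic). *)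

(* Defs.v *)
From HB Require Import structures.
From mathcomp Require Import all_boot all_order all_algebra.
From mathcomp Require Import all_classical all_reals all_analysis.

Set Implicit Arguments.
Unset Strict Implicit.
Unset Printing Implicit Defensive.

Import Order.TTheory GRing.Theory Num.Theory numFieldNormedType.Exports.

Local Open Scope classical_set_scope.
Local Open Scope ring_scope.

(* An infinite word z_1 z_2 z_3 ... is indexed from 0: [w i] is the letter
   z_(i+1). *)
Definition word (L : Type) := nat -> L.

(* The alphabet is a set [B] of letters, the edges being labelled in [B]. *)
Record automaton (L : Type) (B : set L) := Automaton {
  state : Type;
  edge : state -> L -> state -> Prop;
  initial : set state;
  terminal : set state;
  edge_label : forall p b q, edge p b q -> B b
}.

Definition finite_automaton (L : Type) (B : set L) (D : automaton B) : Prop :=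
  finite_set [set: state D].

Definition is_path (L : Type) (B : set L) (D : automaton B)
    (p : nat -> state D) (w : word L) : Prop :=
  forall i, edge (p i) (w i) (p i.+1).

Definition successful (L : Type) (B : set L) (D : automaton B)
    (p : nat -> state D) : Prop :=
  initial (p 0%N) /\ (forall m, exists2 n, (m <= n)%N & terminal (p n)).

Definition buchi_language (L : Type) (B : set L) (D : automaton B) :
    set (word L) :=
  [set w | exists p : nat -> state D, is_path p w /\ successful p].

Definition buchi_recognizable (L : Type) (B : set L) (X : set (word L)) : Prop :=
  exists D : automaton B, finite_automaton D /\ buchi_language D = X.

Definition digits (M : nat) : set int := [set a | - M%:Z <= a <= M%:Z].

Definition zero_words (R : realType) (beta : R) (M : nat) : set (word int) :=
  [set z | (forall i, digits M (z i)) /\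
           series (fun i => (z i)%:~R * beta ^- i.+1) @ \oo --> (0 : R)].

Definition spectrum (R : realType) (A : set int) (beta : R) : set R :=
  [set x | exists (n : nat) (a : nat -> int),
     (forall k, (k <= n)%N -> A (a k)) /\
     x = \sum_(k < n.+1) (a k)%:~R * beta ^+ k].

(* Equivalent to the library's [limit_point] by [limit_point_infinite_setP]. *)
Definition accumulation_point (R : realType) (X : set R) (s : R) : Prop :=
  forall U, nbhs s U -> infinite_set (U `&` X).

(* Main.v *)
(* Reading a word z letter by letter in Horner style, s_0 = 0 and
   s_(n+1) = beta s_n + z_(n+1), visits exactly the spectrum S. With
   c = M / (beta - 1), one step multiplies the excess |s_n| - c by at least
   beta; hence z lies in Z iff |s_n| <= c for all n, and both sides of the
   equivalence amount to the finiteness of F = S `&` [-c, c].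

   If F is finite, it is the state set of an automaton recognizing Z, with all
   states terminal. Conversely, if beta <= 2M + 1, each s_n in F extends
   greedily to a word of Z, and the state reached after n letters determines
   s_n, so F has at most as many elements as there are states; if
   beta > 2M + 1, then F is contained in {0}.

   If F is finite, points of S leaving [-c, c] do so with an excess bounded
   below, and the excess then grows geometrically, so that S meets every
   bounded interval in a finite set. The converse is Bolzano-Weierstrass. *)

Require Import Defs.
From mathcomp Require Import all_boot all_order all_algebra.
From mathcomp Require Import all_classical all_reals all_analysis.
From mathcomp Require Import lra zify.

Set Implicit Arguments.
Unset Strict Implicit.
Unset Printing Implicit Defensive.

Import Order.TTheory GRing.Theory Num.Theory numFieldNormedType.Exports.

Local Open Scope classical_set_scope.
Local Open Scope ring_scope.

(** * Powers of [beta], digits, and Horner evaluation of prefixes *)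

Lemma expr_unbounded (R : realType) (beta K : R) :
  1 < beta -> exists n, K <= beta ^+ n.
Proof.
move=> hbeta; have b0 : 0 < beta by apply: lt_trans hbeta.
have hV : `|beta^-1| < 1 by rewrite gtr0_norm ?invr_gt0// invf_lt1.
have K0 : 0 < `|K| + 1 by rewrite ltr_wpDl.
have /cvgrPdist_lt /(_ (`|K| + 1)^-1) := cvg_expr hV.
rewrite invr_gt0 => /(_ K0)[n _ /(_ n (leqnn n))] /=.
rewrite sub0r normrN exprVn gtr0_norm ?invr_gt0 ?exprn_gt0//.
rewrite ltf_pV2 ?posrE ?exprn_gt0// => hn; exists n.
by apply: le_trans (ltW hn); apply: le_trans (ler_norm K) _; rewrite lerDl.
Qed.

Lemma digitsP (R : realType) (M : nat) (a : int) :
  digits M a <-> `|a%:~R : R| <= M%:R.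
Proof. by rewrite -intr_norm -[M%:R]/((M%:Z)%:~R) ler_int ler_norml. Qed.

Lemma finite_digits M : finite_set (digits M).
Proof.
apply: (@sub_finite_set _ _
  ([set k%:Z | k in `I_M.+1] `|` [set - k%:Z | k in `I_M.+1])).
  move=> [k|k]; rewrite /digits /= => /andP[h1 h2].
    by left; exists k => //=; rewrite ltnS.
  by right; exists k.+1 => //=; rewrite ltnS -lez_nat -lerN2 -NegzE.
by rewrite finite_setU; split; apply: finite_image; exact: finite_II.
Qed.

(* The value of the first [n] letters of [z], scaled by [beta ^+ n] so as to
   be an integer polynomial in [beta]. *)
Fixpoint horner_value (R : realType) (beta : R) (z : word int) (n : nat) : R :=
  if n is m.+1 then beta * horner_value beta z m + (z m)%:~R else 0.

(** This is the sum of M beta^(-i) over i >= 1, the most that a tail of digits can contribute. *)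
Definition horner_bound (R : realType) (beta : R) (M : nat) : R :=
  M%:R / (beta - 1).

(** The choice [K = horner_bound beta M] gives the set F above; larger [K] serve to control the
    spectrum near an arbitrary point. *)
Definition small_spectrum (R : realType) (beta : R) (M : nat) (K : R) : set R :=
  [set x | spectrum (digits M) beta x /\ `|x| <= K].

Lemma horner_valueE (R : realType) (beta : R) (z : word int) n :
  horner_value beta z n = \sum_(k < n) (z (n - k.+1)%N)%:~R * beta ^+ k.
Proof.
elim: n => [|n IH] /=; first by rewrite big_ord0.
rewrite big_ord_recl expr0 mulr1 subSS subn0 addrC; congr (_ + _).
rewrite IH mulr_sumr; apply: eq_bigr => k _.
by rewrite lift0 subSS exprS mulrCA.
Qed.

Lemma eq_horner_value (R : realType) (beta : R) (z z' : word int) n :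
  (forall i, (i < n)%N -> z i = z' i) ->
  horner_value beta z n = horner_value beta z' n.
Proof.
elim: n => [//|n IH] h /=; rewrite h// IH// => i hi.
by apply: h; apply: ltnW.
Qed.

Lemma horner_value_cat (R : realType) (beta : R) (z : word int) n k :
  horner_value beta z (n + k) = beta ^+ k * horner_value beta z n
    + horner_value beta (fun i => z (n + i)%N) k.
Proof.
elim: k => [|k IH]; first by rewrite addn0 expr0 mul1r addr0.
by rewrite addnS /= IH exprS mulrDr mulrA addrA.
Qed.

Lemma spectrumP (R : realType) (beta : R) M x :
  spectrum (digits M) beta x <->
  exists (z : word int) n,
    (forall i, digits M (z i)) /\ x = horner_value beta z n.
Proof.
have d0 : digits M 0 by rewrite /digits /= oppr_le0 !lez_nat.
split=> [[n [a [ha ->]]]|[z [n [hz ->]]]].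
  (* Horner evaluation reads the leading coefficient first. Beyond [n], truncated subtraction pads
     the word with the digit [a 0]. *)
  exists (fun i => a (n - i)%N), n.+1; split.
    by move=> i; apply: ha; rewrite leq_subr.
  rewrite horner_valueE; apply: eq_bigr => k _.
  by rewrite subSS subKn// -ltnS.
(* A point of the spectrum has at least one coefficient, so the empty prefix is represented by the
   single digit 0. *)
case: n => [|n].
  exists 0%N, (fun=> 0); split=> //=.
  by rewrite big_ord1 mul0r.
exists n, (fun k => z (n.+1 - k.+1)%N); split=> //.
by rewrite horner_valueE.
Qed.

Lemma spectrum_step (R : realType) (beta : R) M x a :
  spectrum (digits M) beta x -> digits M a ->
  spectrum (digits M) beta (beta * x + a%:~R).
Proof.
move=> /spectrumP[z [n [hz ->]]] ha; apply/spectrumP.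
exists (fun i => if (i < n)%N then z i else a), n.+1; split.
  by move=> i; case: ifP.
rewrite /= ltnn; congr (_ * _ + _); apply: eq_horner_value => i ->//.
Qed.

Lemma spectrum_ind (R : realType) (beta : R) M (P : R -> Prop) :
  P 0 ->
  (forall x a, spectrum (digits M) beta x -> digits M a -> P x ->
    P (beta * x + a%:~R)) ->
  forall x, spectrum (digits M) beta x -> P x.
Proof.
move=> P0 PS x /spectrumP[z [n [hz ->]]]; elim: n => [//|n IH] /=.
by apply: PS => //; apply/spectrumP; exists z, n.
Qed.

Lemma spectrum0 (R : realType) (beta : R) M : spectrum (digits M) beta 0.
Proof.
apply/spectrumP; exists (fun=> 0), 0%N; split=> // i.
by rewrite /digits /= oppr_le0 !lez_nat.
Qed.

(** * Growth of the excess and characterization of [zero_words] *)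

Lemma beta_horner_bound (R : realType) (beta : R) M :
  1 < beta -> beta * horner_bound beta M = horner_bound beta M + M%:R.
Proof.
move=> hb; have : horner_bound beta M * (beta - 1) = M%:R.
  by rewrite /horner_bound divfK// subr_eq0 gt_eqF.
by lra.
Qed.

Lemma horner_bound_ge0 (R : realType) (beta : R) M :
  1 < beta -> 0 <= horner_bound beta M.
Proof. by move=> hb; rewrite divr_ge0// subr_ge0 ltW. Qed.

(** A digit costs at most M, which is exactly the amount by which beta c exceeds c, for c the
    [horner_bound]. *)
Lemma excess_step (R : realType) (beta : R) M x a : 1 < beta -> digits M a ->
  beta * (`|x| - horner_bound beta M)
    <= `|beta * x + a%:~R| - horner_bound beta M.
Proof.
move=> hb /(digitsP R) ha.
have := lerB_normD (beta * x) (a%:~R).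
rewrite normrM (gtr0_norm (lt_trans ltr01 hb)) mulrBr beta_horner_bound//.
by lra.
Qed.

Lemma excess_growth (R : realType) (beta : R) M (z : word int) n k :
  1 < beta -> (forall i, digits M (z i)) ->
  beta ^+ k * (`|horner_value beta z n| - horner_bound beta M)
    <= `|horner_value beta z (n + k)| - horner_bound beta M.
Proof.
move=> hb hz; elim: k => [|k IH]; first by rewrite expr0 mul1r addn0.
rewrite addnS /= exprS -mulrA; apply: le_trans (excess_step _ hb (hz _)).
by rewrite ler_pM2l// (lt_trans ltr01 hb).
Qed.

Lemma seriesE_horner (R : realType) (beta : R) (z : word int) n : 1 < beta ->
  series (fun i => (z i)%:~R * beta ^- i.+1) n
    = horner_value beta z n / beta ^+ n.
Proof.
move=> hb; have b0 : beta != 0 by rewrite gt_eqF// (lt_trans ltr01 hb).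
rewrite seriesEnat /=; elim: n => [|n IH]; first by rewrite big_geq// mul0r.
rewrite big_nat_recr//= IH mulrDl; congr (_ + _).
by rewrite exprS invfM mulrACA divff// mul1r.
Qed.

Lemma zero_wordsP (R : realType) (beta : R) M (z : word int) : 1 < beta ->
  zero_words beta M z <-> (forall i, digits M (z i)) /\
    forall n, `|horner_value beta z n| <= horner_bound beta M.
Proof.
move=> hb; have b0 : 0 < beta by apply: lt_trans hb.
have c0 := horner_bound_ge0 M hb.
rewrite /zero_words /= (_ : series _ =
  fun n => horner_value beta z n / beta ^+ n); last first.
  by apply/funext => n; rewrite seriesE_horner.
split=> -[hz].
- move=> hlim; split=> // n; rewrite leNgt; apply/negP => hn.
  (* By [excess_growth], all partial sums from [n] on stay at least this far from 0. *)
  have d0 : 0 < (`|horner_value beta z n| - horner_bound beta M) / beta ^+ n.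
    by rewrite divr_gt0 ?exprn_gt0// subr_gt0.
  have /cvgrPdist_lt /(_ _ d0)[N _ /(_ (n + N)%N (leq_addl _ _))] := hlim.
  rewrite /= sub0r normrN normrM normfV (gtr0_norm (exprn_gt0 _ b0)).
  apply/negP; rewrite -leNgt ler_pdivlMr ?exprn_gt0// exprD mulrA.
  rewrite divfK ?expf_neq0 ?gt_eqF// mulrC.
  apply: le_trans (excess_growth _ _ hb hz) _.
  by rewrite gerBl.
- move=> hbd; split=> //; apply/cvgrPdist_le => e e0.
  have [N hN] := expr_unbounded (horner_bound beta M / e) hb.
  exists N => // n /= hn; rewrite sub0r normrN normrM normfV.
  rewrite (gtr0_norm (exprn_gt0 _ b0)) ler_pdivrMr ?exprn_gt0//.
  apply: le_trans (hbd n) _; rewrite -ler_pdivrMl// mulrC.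
  by apply: le_trans hN _; rewrite ler_weXn2l// ltW.
Qed.

(** * Finiteness of F and accumulation points *)

Lemma finite_lower_bound (R : realType) (A : set R) (c : R) :
  finite_set A -> (forall x, A x -> c < x) ->
  exists2 d, 0 < d & forall x, A x -> c + d <= x.
Proof.
move=> /finite_seqP[s ->]; elim: s => [|y s IH] h.
  by exists 1 => // x; rewrite /= in_nil.
have [|d d0 hd] := IH; first by move=> x hx; apply: h; rewrite /= inE hx orbT.
have cy : c < y by apply: h; rewrite /= mem_head.
exists (Num.min d (y - c)); first by rewrite lt_min d0 subr_gt0.
move=> x; rewrite /= inE => /orP[/eqP->|hx].
  by rewrite -lerBrDl ge_min lexx orbT.
by apply: le_trans (hd _ hx); rewrite lerD2l ge_min lexx.
Qed.

(** A point outside [-c, c] either has just left F, which allows finitely many absolute values (the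
    set [E]), or comes from a point already outside, whose excess is multiplied by at least beta >
    1. *)
Lemma spectrum_gap (R : realType) (beta : R) M : 1 < beta ->
  finite_set (small_spectrum beta M (horner_bound beta M)) ->
  exists2 d, 0 < d & forall x, spectrum (digits M) beta x ->
    horner_bound beta M < `|x| -> horner_bound beta M + d <= `|x|.
Proof.
move=> hb hfin; set c := horner_bound beta M in hfin *.
have b0 : 0 < beta by apply: lt_trans hb.
pose E := [set `|beta * x + a%:~R| | x in small_spectrum beta M c
   & a in digits M] `&` [set y | c < y].
have [|y []//|d d0 hd] := @finite_lower_bound R E c.
  apply: sub_finite_set (@subIsetl _ _ _) _.
  by apply: (finite_image2 (fun x a => `|beta * x + a%:~R|)) => //;
     exact: finite_digits.
exists d => //; refine (spectrum_ind _ _).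
  by rewrite normr0 ltNge horner_bound_ge0.
move=> x a hx ha IH hc; have [xc|xc] := leP `|x| c.
  by apply: hd; split=> //; exists x => //; exists a.
have := excess_step x hb ha; have := IH xc; rewrite -/c => h1 h2.
have : d <= beta * (`|x| - c).
  apply: (@le_trans _ _ (beta * d)); first by rewrite ler_peMl// ltW.
  by rewrite ler_pM2l//; lra.
by lra.
Qed.

(** A predecessor of a point of excess at most beta e has excess at most e, and there are finitely
    many digits; only the starting point 0 may lack a predecessor. *)
Lemma small_spectrum_grow (R : realType) (beta : R) M e : 1 < beta ->
  0 <= e ->
  finite_set (small_spectrum beta M (horner_bound beta M + e)) ->
  finite_set (small_spectrum beta M (horner_bound beta M + beta * e)).
Proof.
move=> hb e0 hfin; set c := horner_bound beta M in hfin *.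
have b0 : 0 < beta by apply: lt_trans hb.
apply: (@sub_finite_set _ _ ([set 0] `|` [set beta * x + a%:~R | x in
   small_spectrum beta M (c + e) & a in digits M])); last first.
  rewrite finite_setU; split; first exact: finite_set1.
  by apply: (finite_image2 (fun x a => beta * x + a%:~R)) => //;
     exact: finite_digits.
move=> x [hx]; move: x hx; refine (spectrum_ind _ _); first by left.
move=> x a hx ha _ hxe; right; exists x; last by exists a.
split=> //; have := excess_step x hb ha; rewrite -/c => h.
have : beta * (`|x| - c) <= beta * e by lra.
by rewrite ler_pM2l//; lra.
Qed.

Lemma small_spectrum_finite (R : realType) (beta : R) M : 1 < beta ->
  finite_set (small_spectrum beta M (horner_bound beta M)) ->
  forall K, finite_set (small_spectrum beta M K).
Proof.
move=> hb hfin K; have [d d0 hd] := spectrum_gap hb hfin.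
set c := horner_bound beta M in hfin hd *.
(* Since d / 2 lies below the gap [d], the case [n = 0] adds no point to F. *)
have h n : finite_set (small_spectrum beta M (c + beta ^+ n * (d / 2))).
  elim: n => [|n IH]; last first.
    rewrite exprS -mulrA; apply: small_spectrum_grow => //.
    by rewrite mulr_ge0 ?exprn_ge0 ?divr_ge0 ?(ltW d0)// ltW// (lt_trans ltr01).
  apply: sub_finite_set hfin => x [hx hxc]; split=> //.
  by rewrite leNgt; apply/negP => /(hd _ hx); move: hxc; rewrite mul1r; lra.
have [n hn] := expr_unbounded ((K - c) / (d / 2)) hb.
apply: sub_finite_set (h n) => x [hx hxK]; split=> //.
apply: le_trans hxK _; rewrite -lerBlDl -ler_pdivrMr//.
by rewrite divr_gt0.
Qed.

Lemma finite_small_spectrumP (R : realType) (beta : R) M : 1 < beta ->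
  finite_set (small_spectrum beta M (horner_bound beta M)) <->
  ~ (exists s : R, accumulation_point (spectrum (digits M) beta) s).
Proof.
move=> hb; split=> [hfin [s hs]|hacc].
  apply: (hs (ball s 1)); first exact: nbhsx_ballx.
  apply: sub_finite_set (small_spectrum_finite hb hfin (`|s| + 1)).
  move=> x [sx hx]; split=> //; rewrite -[x](subKr s).
  apply: le_trans (ler_normB _ _) _; rewrite lerD2l.
  by move: sx; rewrite /ball /= => /ltW.
apply: contrapT => hinf; apply: hacc.
have [|s hs] := infinite_bounded_limit_point_nonempty hinf.
  exists (horner_bound beta M); split; first exact: num_real.
  by move=> y hy x [_ hx]; apply: le_trans hx (ltW hy).
exists s => U hU hUS.
apply: ((limit_point_infinite_setP _ _).1 hs _ hU).
by apply: sub_finite_set hUS => x [Ux [hx _]]; split.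
Qed.

(** * From a finite F to an automaton *)

Lemma recognizable_of_finite (R : realType) (beta : R) M : 1 < beta ->
  finite_set (small_spectrum beta M (horner_bound beta M)) ->
  buchi_recognizable (digits M) (zero_words beta M).
Proof.
move=> hb; set c := horner_bound beta M => /finite_seqP[s hs].
have inS x : small_spectrum beta M c x -> x \in s by rewrite hs.
have Sin x : x \in s -> small_spectrum beta M c x by rewrite hs.
(* States are the points of F, so the only possible path from 0 labelled [z] is its sequence of
   Horner values, and it exists only while these stay in F. *)
pose edge (x : seq_sub s) (a : int) (y : seq_sub s) :=
  digits M a /\ ssval y = beta * ssval x + a%:~R.
have edge_digit x a y : edge x a y -> digits M a by case.
exists (Automaton [set x | ssval x = 0] setT edge_digit); split.
  exact: finite_finset.
apply/seteqP; split=> [z [p [hp [h0 _]]]|z].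
  apply/(zero_wordsP _ _ hb); split=> [i|n]; first by case: (hp i).
  have -> : horner_value beta z n = ssval (p n).
    by elim: n => [|n IH] //=; rewrite IH; case: (hp n) => _ ->.
  by case: (Sin _ (ssvalP (p n))).
move=> /(zero_wordsP _ _ hb)[hz hbd].
have hin n : horner_value beta z n \in s.
  by apply: inS; split=> //; apply/spectrumP; exists z, n.
exists (fun n => SeqSub (hin n)); split; first by move=> i; split.
by split=> // m; exists m.
Qed.

(** * From an automaton to a finite F *)

(** Here c < 1. The predecessor of a point of F is in F, hence 0 by induction, so the point itself
    is an integer of absolute value below 1. *)
Lemma small_spectrum_large_base (R : realType) (beta : R) M :
  1 < beta -> M.*2%:R < beta - 1 ->
  small_spectrum beta M (horner_bound beta M) `<=` [set 0].
Proof.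
move=> hb hM x [hx]; move: x hx; refine (spectrum_ind _ _) => //.
set c := horner_bound beta M.
have b1 : 0 < beta - 1 by rewrite subr_gt0.
have c1 : c < 1.
  by rewrite /c /horner_bound ltr_pdivrMr// mul1r; apply: le_lt_trans hM;
     rewrite ler_nat -addnn leq_addr.
move=> x a hx ha IH hxa; have xc : `|x| <= c.
  have := excess_step x hb ha; rewrite -/c => h.
  have : beta * (`|x| - c) <= 0 by lra.
  by rewrite pmulr_rle0 ?subr_le0// (lt_trans ltr01).
move: hxa; rewrite (IH xc) mulr0 add0r => hac; apply/eqP.
rewrite intr_eq0 -normr_le0 -ltzD1 add0r -(@ltr_int R) intr_norm.
exact: le_lt_trans hac c1.
Qed.

(** For |y| < M, cancel the integer nearest to y, with error at most 1/2; otherwise use an extreme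
    digit. *)
Lemma digit_cover (R : realType) (M : nat) (c y : R) :
  2^-1 <= c -> `|y| <= c + M%:R ->
  exists2 a, digits M a & `|y + a%:~R| <= c.
Proof.
move=> hc; rewrite ler_norml => /andP[y1 y2].
have [hM|hM] := leP M%:R y.
  exists (- M%:Z); first by rewrite /digits /= lexx/= ge0_cp.
  rewrite intrN ler_norml -[(M%:Z)%:~R]/(M%:R : R); apply/andP; split; lra.
have [hM'|hM'] := leP y (- M%:R).
  exists M%:Z; first by rewrite /digits /= lexx/= ge0_cp.
  rewrite ler_norml -[(M%:Z)%:~R]/(M%:R : R); apply/andP; split; lra.
have /andP[f1 f2] := floor_itv y; set k := Num.floor y in f1 f2.
have k1 : - M%:Z <= k.
  by rewrite -ltzD1 -(@ltr_int R) intrN; apply: lt_trans hM' _.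
have k2 : k + 1 <= M%:Z by rewrite lezD1 -(@ltr_int R); apply: le_lt_trans hM.
rewrite intrD in f2.
have [hy|hy] := leP (y - k%:~R) (2^-1).
  exists (- k); first by rewrite /digits /= lerN2 lerNl k1 andbT; lia.
  by rewrite intrN ler_norml; apply/andP; split; lra.
exists (- (k + 1)); first by rewrite /digits /=; apply/andP; split; lia.
by rewrite intrN intrD ler_norml; apply/andP; split; lra.
Qed.

(** The condition on [beta] says c >= 1/2, and |x| <= c gives |beta x| <= c + M, so [digit_cover]
    always supplies a digit leading back into [-c, c]. *)
Lemma zero_word_extension (R : realType) (beta : R) M (z : word int) n :
  1 < beta -> beta - 1 <= M.*2%:R -> (forall i, digits M (z i)) ->
  `|horner_value beta z n| <= horner_bound beta M ->
  exists2 z', zero_words beta M z' &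
    horner_value beta z' n = horner_value beta z n.
Proof.
move=> hb hM hz; set c := horner_bound beta M; set x := horner_value beta z n.
move=> xc; have b0 : 0 < beta by apply: lt_trans hb.
have b1 : 0 < beta - 1 by rewrite subr_gt0.
have c2 : 2^-1 <= c.
  rewrite /c /horner_bound ler_pdivlMr//.
  by move: hM; rewrite -muln2 natrM; lra.
have hg y : exists a, digits M a /\ (`|y| <= c -> `|beta * y + a%:~R| <= c).
  (* Outside [-c, c] any digit will do; [z 0] merely makes the choice function total. *)
  have [yc|yc] := leP `|y| c; last by exists (z 0%N).
  have [|a ha h] := @digit_cover R M c (beta * y) c2; last by exists a.
  by rewrite normrM (gtr0_norm b0) -beta_horner_bound// ler_pM2l.
have [g gP] := choice hg.
pose t := fix t k := if k is j.+1 then beta * t j + (g (t j))%:~R else x.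
pose z' i := if (i < n)%N then z i else g (t (i - n)%N).
have hz' i : digits M (z' i).
  by rewrite /z'; case: ifP => _; [exact: hz | case: (gP (t (i - n)%N))].
have z'n : horner_value beta z' n = x.
  by apply: eq_horner_value => i hi; rewrite /z' hi.
have tc k : `|t k| <= c by elim: k => [//|k IH] /=; apply: (gP _).2.
have z't k : horner_value beta z' (n + k) = t k.
  elim: k => [|k IH]; first by rewrite addn0.
  by rewrite addnS /= IH /z' ltnNge leq_addr /= addKn.
exists z' => //; apply/(zero_wordsP _ _ hb); split=> // m.
have [nm|mn] := leqP n m; first by rewrite -(subnKC nm) z't.
(* A positive excess at an earlier [m] would persist up to [n], against [xc]. *)
rewrite leNgt; apply/negP => hm.
have := @excess_growth R beta M z' m (n - m) hb hz'.
rewrite (subnKC (ltnW mn)) z'n -/c => h.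
have : 0 < beta ^+ (n - m) * (`|horner_value beta z' m| - c).
  by rewrite mulr_gt0 ?exprn_gt0// subr_gt0.
by lra.
Qed.

(* Two prefixes leading to the same state have the same set of continuations
   in [Z], and a single continuation already determines the value of the
   prefix. *)
Lemma path_state_value (R : realType) (beta : R) M (D : automaton (digits M))
    (p p' : nat -> state D) (z z' : word int) n n' : 1 < beta ->
  buchi_language D = zero_words beta M ->
  is_path p z -> successful p -> is_path p' z' -> successful p' ->
  p n = p' n' -> horner_value beta z n = horner_value beta z' n'.
Proof.
move=> hb hD hp sp hp' sp' hpp; have b0 : 0 < beta by apply: lt_trans hb.
(* Splice the first [n] steps of [p] with [p'] from time [n'] on; [hpp] makes the junction an
   edge. *)
pose q i := if (i < n)%N then p i else p' (i - n + n')%N.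
pose y i := if (i < n)%N then z i else z' (i - n + n')%N.
have yZ : zero_words beta M y.
  rewrite -hD; exists q; split.
    move=> i; rewrite /q /y; have [hi|hi] := ltnP i n; last first.
      by rewrite ltnNge (leqW hi)/= subSn// addSn; apply: hp'.
    have [_|hi'] := ltnP i.+1 n; first exact: hp.
    have -> : i.+1 = n by apply/eqP; rewrite eqn_leq hi hi'.
    rewrite subnn add0n -hpp (_ : n = i.+1); first exact: hp.
    by apply/eqP; rewrite eqn_leq hi hi'.
  split.
    rewrite /q; case: ltnP => [_|]; first exact: sp.1.
    by rewrite leqn0 => /eqP n0; rewrite n0 subnn add0n -hpp n0; exact: sp.1.
  (* Terminal visits come from [p']; the offset [n'] makes up for the part of [p'] that is cut
     off. *)
  move=> m; have [k hk tk] := sp'.2 (m + n')%N.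
  have nk : (n' <= k)%N by apply: leq_trans hk; exact: leq_addl.
  exists (n + (k - n'))%N; last first.
    by rewrite /q ltnNge leq_addr /= addKn subnK.
  by apply: leq_trans (leq_addl _ _); rewrite leq_subRL// addnC.
have z'Z : zero_words beta M z' by rewrite -hD; exists p'.
have [_ hy] := (zero_wordsP M y hb).1 yZ.
have [_ hz'] := (zero_wordsP M z' hb).1 z'Z.
have yn : horner_value beta y n = horner_value beta z n.
  by apply: eq_horner_value => i hi; rewrite /y hi.
rewrite -yn; apply/eqP; rewrite -subr_eq0 -normr_le0 leNgt; apply/negP => d0.
set d := `|_| in d0; set c := horner_bound beta M in hy hz'.
(* After [k] more common letters the two values differ by beta^k d >= 2 c + 1, yet both lie in
   [-c, c]. *)
have [k hk] := expr_unbounded ((2 * c + 1) / d) hb.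
have := hy (n + k)%N; have := hz' (n' + k)%N; rewrite !horner_value_cat.
rewrite (_ : (fun i => y (n + i)%N) = (fun i => z' (n' + i)%N)); last first.
  by apply/funext => i; rewrite /y ltnNge leq_addr /= addKn addnC.
set v := horner_value _ _ k => h1 h2.
have := ler_normB (beta ^+ k * horner_value beta y n + v)
  (beta ^+ k * horner_value beta z' n' + v).
rewrite opprD addrACA subrr addr0 -mulrBr normrM -/d.
rewrite (gtr0_norm (exprn_gt0 _ b0)).
by move: hk; rewrite ler_pdivrMr//; lra.
Qed.

Lemma finite_of_recognizable (R : realType) (beta : R) M : 1 < beta ->
  buchi_recognizable (digits M) (zero_words beta M) ->
  finite_set (small_spectrum beta M (horner_bound beta M)).
Proof.
move=> hb [D [finD hD]].
have [hM|hM] := leP (beta - 1) M.*2%:R; last first.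
  exact: sub_finite_set (small_spectrum_large_base hb hM) (finite_set1 _).
pose reaches (q : state D) (x : R) := exists p z n,
  [/\ is_path p z, successful p, p n = q & horner_value beta z n = x].
(* By [path_state_value] at most one value qualifies; the default 0 concerns only states on no
   successful path. *)
pose f q := xget 0 [set x | reaches q x].
apply: sub_finite_set (finite_image f finD) => x [/spectrumP[z [n [hz ->]]] hx].
have [z' z'Z <-] := zero_word_extension hb hM hz hx.
have [p [hp sp]] : buchi_language D z' by rewrite hD.
exists (p n) => //; rewrite /f; case: xgetP => [y _|noval].
  by move=> [p' [z1 [m [hp' sp' hpp <-]]]]; apply: path_state_value hpp.
by case: (noval (horner_value beta z' n)); exists p, z', n.
Qed.

Local Close Scope classical_set_scope.

Theorem theorem4p2 (R : realType) (beta : R) (M : nat)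
    (hbeta : 1 < beta) (hM : (1 <= M)%N) :
  buchi_recognizable (digits M) (zero_words beta M) <->
  ~ (exists s : R, accumulation_point (spectrum (digits M) beta) s).
Proof.
split=> [/(finite_of_recognizable hbeta)|/(finite_small_spectrumP _ hbeta)].
  exact: (finite_small_spectrumP M hbeta).1.
exact: recognizable_of_finite.
Qed.
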